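(* Let $F$ be a field of characteristic $2$, let $m \geq 1$ be an integer, and set $n := 2 \cdot 3^m$. Let $x_1, \dots, x_n$ be independent variables over $F$, let $K_n := F(x_1, \dots, x_n)^{S_n}$ and $L_n := F(x_1, \dots, x_n)^{S_{n-1}}$. Then there is no $y \in L_n \setminus K_n$ such that $\sigma_1(y) = \sigma_3(y) = 0$.
   Context: The symmetric group $S_n$ acts on the rational function field $F(x_1,\dots,x_n)$ by permuting $x_1,\dots,x_n$, and $S_{n-1}\subset S_n$ is the subgroup permuting $x_2,\dots,x_n$ (fixing $x_1$). Thus $K_n = F(a_1,\dots,a_n)$ with $a_i$ the $i$-th elementary symmetric polynomial in $x_1,\dots,x_n$, and $L_n = K_n(x_1)$ is a separable field extension of $K_n$ of degree $n$. For a field extension $L/K$ of degree $n$ and $y\in L$, the elements $\sigma_i(y)\in K$ are defined by writing the characteristic polynomial of the $K$-linear map $L\to L$, $z\mapsto yz$, as $t^n - \sigma_1(y)t^{n-1} + \sigma_2(y)t^{n-2} - \dots + (-1)^n\sigma_n(y)$; here the extension is $L_n/K_n$. *)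

(* Defs.v *)
From HB Require Import structures.
From mathcomp Require Import all_boot all_order all_fingroup all_algebra all_field.
From mathcomp Require Import generic_quotient mpoly.

Set Implicit Arguments.
Unset Strict Implicit.
Unset Printing Implicit Defensive.

Import GRing.Theory passmx.
Local Open Scope ring_scope.
Local Open Scope quotient_scope.

Section CharacteristicPolynomial.
Context (K : fieldType) (L : fieldExtType K).

(* amull y is the K-linear map z |-> y * z. *)
Definition mul_char_poly (y : L) : {poly K} :=
  char_poly (mxof (vbasis {:L}) (vbasis {:L}) (amull y)).

(* With d = [L : K], the characteristic polynomial of y is
   t^d - sigma 1 y t^(d-1) + ... + (-1)^d sigma d y.  The truncated
   subtraction makes sigma i y meaningful only for i <= d. *)
Definition sigma (i : nat) (y : L) : K :=
  (-1) ^+ i * (mul_char_poly y)`_(\dim {:L} - i).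

End CharacteristicPolynomial.

Section FractionMap.
Context (R : idomainType).
Local Notation "x %:F" := (FracField.tofrac x).
Implicit Types (q : {fraction R}) (f g : {rmorphism R -> R}).

Lemma frac_numden q : q = (\n_(repr q))%:F / (\d_(repr q))%:F.
Proof.
have dn0 : \d_(repr q) != 0 by exact: denom_ratioP.
apply: (canRL (mulfK _)); first by rewrite tofrac_eq0.
rewrite -{1}[q]reprK /FracField.tofrac; unlock.
rewrite -[LHS]FracField.pi_mul; apply/eqmodP => /=.
rewrite FracField.equivfE /FracField.mulf /=.
by rewrite !numden_Ratio ?mulr1 ?oner_eq0 // mulrC.
Qed.

Variant frac_spec q : Prop :=
  FracSpec (a b : R) of b != 0 & q = a%:F / b%:F.

Lemma fracP q : frac_spec q.
Proof. exact: FracSpec (denom_ratioP _) (frac_numden q). Qed.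

(* The endomorphism a / b |-> f a / f b of the fraction field; f must be
   injective for this to be independent of the representatives. *)
Definition frac_map (f : R -> R) q : {fraction R} :=
  (f \n_(repr q))%:F / (f \d_(repr q))%:F.

Lemma frac_mapE f a b : injective f -> b != 0 ->
  frac_map f (a%:F / b%:F) = (f a)%:F / (f b)%:F.
Proof.
move=> f_inj b0; rewrite /frac_map; set q := a%:F / b%:F.
have d0 : \d_(repr q) != 0 by exact: denom_ratioP.
have fn0 c : c != 0 -> f c != 0 by rewrite raddf_eq0.
have /eqP := frac_numden q; rewrite {1}/q.
rewrite eqr_div ?tofrac_eq0 // -!tofracM tofrac_eq => /eqP eq_ab.
apply/eqP; rewrite eqr_div ?tofrac_eq0 ?fn0 // -!tofracM tofrac_eq.
by rewrite -!rmorphM eq_ab.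
Qed.

Lemma frac_map_tofrac f a : injective f -> frac_map f a%:F = (f a)%:F.
Proof.
move=> f_inj; rewrite -[a%:F]divr1 -tofrac1 frac_mapE ?oner_eq0 //.
by rewrite rmorph1 tofrac1 divr1.
Qed.

Lemma frac_map_zmod_morphism f : injective f -> zmod_morphism (frac_map f).
Proof.
move=> f_inj p q; case: (fracP p) (fracP q) => a b b0 -> [c d d0 ->].
have fn0 e : e != 0 -> f e != 0 by rewrite raddf_eq0.
rewrite -mulNr addf_div ?tofrac_eq0 // -tofracN -!tofracM -tofracD.
rewrite !frac_mapE ?mulf_neq0 // rmorphD !(rmorphM f) rmorphN.
rewrite tofracD !tofracM tofracN.
by rewrite -addf_div ?tofrac_eq0 ?fn0 // mulNr.
Qed.

Lemma frac_map_monoid_morphism f : injective f -> monoid_morphism (frac_map f).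
Proof.
move=> f_inj; split=> [|p q].
  by rewrite -tofrac1 frac_map_tofrac // rmorph1.
case: (fracP p) (fracP q) => a b b0 -> [c d d0 ->].
by rewrite mulf_div -!tofracM !frac_mapE ?mulf_neq0 // !(rmorphM f) !tofracM mulf_div.
Qed.

Lemma frac_map_comp f g q : injective f -> injective g ->
  frac_map (f \o g) q = frac_map f (frac_map g q).
Proof.
move=> f_inj g_inj; case: (fracP q) => a b b0 ->.
rewrite (frac_mapE (f := f \o g)) //; last exact: inj_comp.
by rewrite (frac_mapE (f := g)) // (frac_mapE (f := f)) // raddf_eq0.
Qed.

End FractionMap.

Section Subfield.
Context (E : fieldType).

Record subfield_of (S : divringClosed E) :=
  Subfield { subfield_val :> E; _ : subfield_val \in S }.

HB.instance Definition _ S := [isSub for @subfield_val S].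
HB.instance Definition _ S := [Choice of subfield_of S by <:].
HB.instance Definition _ S :=
  [SubChoice_isSubIntegralDomain of subfield_of S by <:].
HB.instance Definition _ S :=
  [SubIntegralDomain_isSubField of subfield_of S by <:].

Context (S T : divringClosed E) (sST : {subset S <= T}).

(* T as an extension of S; S is recorded in the type through the inclusion, so
   that the scalar action of S can be canonical. *)
Definition extension_of of {subset S <= T} := subfield_of T.
Local Notation K := (subfield_of S).
Local Notation L := (extension_of sST).

HB.instance Definition _ := SubType.on L.
HB.instance Definition _ := GRing.Field.on L.

Definition ext_scale (c : K) (y : L) : L :=
  (Subfield (sST (valP c)) : L) * y.

Lemma ext_scalerA a b y : ext_scale a (ext_scale b y) = ext_scale (a * b) y.
Proof. by apply: val_inj; rewrite /= mulrA. Qed.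
Lemma ext_scale1r : left_id 1 ext_scale.
Proof. by move=> y; apply: val_inj; rewrite /= mul1r. Qed.
Lemma ext_scalerDr : right_distributive ext_scale +%R.
Proof. by move=> a y z; rewrite /ext_scale mulrDr. Qed.
Lemma ext_scalerDl y : {morph ext_scale^~ y : a b / a + b}.
Proof. by move=> a b; apply: val_inj; rewrite /= mulrDl. Qed.
HB.instance Definition _ := GRing.Zmodule_isLmodule.Build K L
  ext_scalerA ext_scale1r ext_scalerDr ext_scalerDl.

Lemma ext_scalerAl (a : K) (y z : L) : a *: (y * z) = (a *: y) * z.
Proof. exact: mulrA. Qed.
HB.instance Definition _ := GRing.Lmodule_isLalgebra.Build K L ext_scalerAl.

Lemma ext_scalerAr (a : K) (y z : L) : a *: (y * z) = y * (a *: z).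
Proof. exact: mulrCA. Qed.
HB.instance Definition _ := GRing.Lalgebra_isAlgebra.Build K L ext_scalerAr.

Lemma val_extZ (a : K) (y : L) : val (a *: y) = val a * val y.
Proof. by []. Qed.

Lemma val_extX (y : L) j : val (y ^+ j) = val y ^+ j.
Proof. by elim: j => // j IHj; rewrite !exprS -IHj. Qed.

Lemma val_ext_sum (I : finType) (f : I -> L) :
  val (\sum_i f i) = \sum_i val (f i).
Proof. by elim/big_rec2: _ => // i y z _ <-. Qed.

End Subfield.

(* S_(n-1), as the subgroup of S_n fixing the first index and permuting the
   others; the indices 1, ..., n are represented by 0, ..., n - 1. *)
Definition sym_fix1 (n : nat) : {set 'S_n} :=
  [set s : 'S_n | [forall i : 'I_n, (i == 0 :> nat)%N ==> (s i == i)]].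

Section FixedFields.
Context (E : fieldType) (n : nat) (act : 'S_n -> {rmorphism E -> E}).
Implicit Types (A B : {set 'S_n}) (q : E).

Definition fixed_by A : {pred E} := fun q => [forall s in A, act s q == q].

Lemma fixed_byP A q : reflect {in A, forall s, act s q = q} (q \in fixed_by A).
Proof. exact: 'forall_in_eqP. Qed.

Lemma fixed_by_divring_closed A : divring_closed (fixed_by A).
Proof.
split=> [|p q /fixed_byP Fp /fixed_byP Fq|p q /fixed_byP Fp /fixed_byP Fq];
  apply/fixed_byP => s sA; first by rewrite rmorph1.
- by rewrite rmorphB /= Fp ?Fq.
- by rewrite fmorph_div /= Fp ?Fq.
Qed.

HB.instance Definition _ A :=
  GRing.isDivringClosed.Build E (fixed_by A) (fixed_by_divring_closed A).

Lemma fixed_byT_sub A : {subset fixed_by [set: 'S_n] <= fixed_by A}.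
Proof. by move=> q /fixed_byP Fq; apply/fixed_byP => s _; apply/Fq/in_setT. Qed.

Local Notation K := (subfield_of (fixed_by [set: 'S_n])).
Local Notation L := (extension_of (@fixed_byT_sub (sym_fix1 n))).

Context (x : 'I_n -> E).
Hypothesis actM : forall s1 s2 q, act (s1 * s2)%g q = act s2 (act s1 q).
Hypothesis actX : forall s i, act s (x i) = x (s i).
Hypothesis x_inj : injective x.

Let x1 : E := \sum_(i < n | i == 0 :> nat) x i.

Lemma x1_fixed : x1 \in fixed_by (sym_fix1 n).
Proof.
apply/fixed_byP => s; rewrite inE => /forallP s_fix.
rewrite rmorph_sum; apply: eq_bigr => i i0.
by rewrite actX; move: (s_fix i); rewrite i0 => /eqP ->.
Qed.

Let xL : L := Subfield x1_fixed.

(* (1, x_1, ..., x_1^(n-1)) is a K-basis of L (for n = 0, K = L with basis 1). *)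
Let comb (w : 'rV[K]_(n.-1.+1)) : L := \sum_j w 0 j *: xL ^+ j.

Lemma comb_linear : linear comb.
Proof.
move=> a u v; rewrite /comb scaler_sumr -big_split /=.
by apply: eq_bigr => j _; rewrite !mxE scalerDl scalerA.
Qed.

Let comb_poly (w : 'rV[K]_(n.-1.+1)) : {poly E} :=
  \poly_(j < n.-1.+1) val (w 0 (inord j)).

Lemma val_comb w : val (comb w) = (comb_poly w).[x1].
Proof.
rewrite horner_poly val_ext_sum; apply: eq_bigr => j _.
by rewrite inord_val val_extZ val_extX.
Qed.

Lemma comb_inj : injective comb.
Proof.
move=> u v eq_uv; apply/eqP; rewrite -subr_eq0; apply/eqP.
set w := u - v; have w0 : comb w = 0.
  by rewrite /w -[u - v]addrC -scaleN1r comb_linear scaleN1r eq_uv addNr.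
suff p0 : comb_poly w = 0.
  apply/rowP => j; apply: val_inj.
  have /polyP/(_ j) := p0; rewrite coef_poly ltn_ord inord_val coef0 => ->.
  by rewrite mxE.
have px1 : (comb_poly w).[x1] = 0 by rewrite -val_comb w0.
have act_p s : map_poly (act s) (comb_poly w) = comb_poly w.
  apply/polyP => j; rewrite coef_map coef_poly.
  case: ifP => _; last exact: rmorph0.
  by case: (w 0 _) => c /= /fixed_byP; apply; rewrite inE.
have [n0|n_gt0] := posnP n.
  apply: (@roots_geq_poly_eq0 _ _ [:: x1]) => //=.
    by rewrite andbT; apply/rootP.
  by rewrite (leq_trans (size_poly _ _)) // n0.
pose i0 := Ordinal n_gt0.
have x1E : x1 = x i0 by rewrite /x1 (big_pred1 i0).
have px i : (comb_poly w).[x i] = 0.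
  rewrite -(tpermL i0 i) -actX -x1E -[in LHS](act_p (tperm i0 i)).
  by rewrite horner_map px1 rmorph0.
apply: (@roots_geq_poly_eq0 _ _ [seq x i | i : 'I_n]).
- by apply/allP => _ /mapP[i _ ->]; apply/rootP.
- by rewrite map_inj_uniq ?enum_uniq.
- by rewrite size_map size_enum_ord (leq_trans (size_poly _ _)) ?prednK.
Qed.

Lemma comb_surj y : exists w, comb w == y.
Proof.
have [n0|n_gt0] := posnP n.
  have yK : val y \in fixed_by [set: 'S_n].
    apply/fixed_byP => s _; case: y => q /= /fixed_byP; apply.
    rewrite inE; apply/forallP => -[i i_lt]; exfalso.
    by move: i_lt; rewrite n0.
  exists (\row_j if j == 0 then Subfield yK else 0).
  apply/eqP/val_inj; rewrite /comb (bigD1 0) //= big1 => [|j j0].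
    by rewrite addr0 mxE eqxx; exact: mulr1.
  by rewrite mxE (negPf j0) scale0r.
pose i0 := Ordinal n_gt0.
have x1E : x1 = x i0 by rewrite /x1 (big_pred1 i0).
pose yi i := act (tperm i0 i) (val y).
have act1 q : act 1%g q = q.
  by apply: (fmorph_inj (act 1%g)); rewrite -actM mulg1.
have y_fix (s : 'S_n) : s i0 = i0 -> act s (val y) = val y.
  move=> s0; rewrite {yi}; case: y => q /= /fixed_byP; apply; rewrite inE.
  apply/forallP => i; apply/implyP => /eqP i00.
  have -> : i = i0 by exact: val_inj.
  by rewrite s0.
have act_y s : act s (val y) = yi (s i0).
  rewrite -[s in LHS]mulg1 -(tperm2 i0 (s i0)) mulgA actM y_fix //.
  by rewrite permM tpermR.
pose l i : {poly E} :=
  \prod_(j | j != i) ((x i - x j)^-1 *: ('X - (x j)%:P)).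
pose p := \sum_i yi i *: l i.
have act_p s : map_poly (act s) p = p.
  rewrite /p rmorph_sum /= [RHS](reindex_inj (@perm_inj _ s)).
  apply: eq_bigr => i _; rewrite map_polyZ /= -/(yi i).
  rewrite /yi -actM act_y permM tpermL; congr (_ *: _).
  rewrite /l (rmorph_prod (map_poly (act s))) /= [RHS](reindex_inj (@perm_inj _ s)) /=.
  apply: eq_big => j; first by rewrite (inj_eq perm_inj).
  by move=> _; rewrite map_polyZ /= fmorphV rmorphB !actX map_polyXsubC actX.
have p_K j : p`_j \in fixed_by [set: 'S_n].
  by apply/fixed_byP => s _; rewrite -[in RHS](act_p s) coef_map.
have size_p : (size p <= n.-1.+1)%N.
  rewrite (leq_trans (size_sum _ _ _)) //; apply/bigmax_leqP => i _.
  rewrite (leq_trans (size_scale_leq _ _)) // /l scaler_prod.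
  rewrite (leq_trans (size_scale_leq _ _)) // -(big_enum _ _ (predC1 i)) /=.
  by rewrite size_prod_XsubC -cardE cardC1 card_ord.
exists (\row_j Subfield (p_K j)); apply/eqP/val_inj; rewrite val_comb x1E.
have -> : comb_poly (\row_j Subfield (p_K j)) = p.
  apply/polyP => j; rewrite coef_poly; case: ltnP => [j_lt|j_ge].
    by rewrite mxE /= inordK.
  by rewrite nth_default // (leq_trans size_p).
rewrite /p horner_sum (bigD1 i0) //= big1 => [|i i_neq].
  rewrite addr0 hornerZ /l horner_prod big1 => [|j j_neq].
    by rewrite mulr1 /yi tperm1 act1.
  rewrite hornerZ hornerXsubC mulVf // subr_eq0 (inj_eq x_inj).
  by rewrite eq_sym.
rewrite hornerZ /l horner_prod (bigD1 i0) 1?eq_sym //=.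
by rewrite hornerZ hornerXsubC subrr mulr0 mul0r mulr0.
Qed.

Lemma fixed_ext_vector_axiom : Vector.axiom n.-1.+1 L.
Proof.
pose v2r y := xchoose (comb_surj y).
have v2rK : cancel v2r comb by move=> y; apply/eqP/(xchooseP (comb_surj y)).
have combK : cancel comb v2r by move=> w; apply: comb_inj; rewrite v2rK.
exists v2r; last by exists comb.
by move=> a u v; apply: comb_inj; rewrite comb_linear !v2rK.
Qed.

End FixedFields.

Section RationalFunctions.
Context (F : fieldType) (n : nat).
Local Notation "x %:F" := (FracField.tofrac x).

Definition ratfun := {fraction {mpoly F[n]}}.
HB.instance Definition _ := GRing.Field.on ratfun.

Definition ratX (i : 'I_n) : ratfun := ('X_i)%:F.

(* The F-automorphism x_i |-> x_(s i) of F(x_1, ..., x_n): see fsymX, fsymC. *)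
Definition fsym (s : 'S_n) : ratfun -> ratfun := frac_map (msym s).

HB.instance Definition _ s := GRing.isZmodMorphism.Build ratfun ratfun (fsym s)
  (frac_map_zmod_morphism (@inj_msym n F s)).
HB.instance Definition _ s := GRing.isMonoidMorphism.Build ratfun ratfun (fsym s)
  (frac_map_monoid_morphism (@inj_msym n F s)).

Definition fsym_action (s : 'S_n) : {rmorphism ratfun -> ratfun} := fsym s.

Lemma fsymX s i : fsym s (ratX i) = ratX (s i).
Proof.
rewrite /fsym /ratX frac_map_tofrac; last exact: inj_msym.
congr (_%:F); exact: etrans (mmapX _ _ _) (mmap1U _ _).
Qed.

Lemma fsymC s (c : F) : fsym s (c%:MP)%:F = (c%:MP)%:F.
Proof.
rewrite /fsym frac_map_tofrac; last exact: inj_msym.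
congr (_%:F); exact: mmapC.
Qed.

Lemma fsymM s1 s2 q : fsym (s1 * s2)%g q = fsym s2 (fsym s1 q).
Proof.
rewrite /fsym -frac_map_comp; [|exact: inj_msym..].
by rewrite /frac_map /= !msymMm.
Qed.

Lemma ratX_inj : injective ratX.
Proof.
move=> i j /eqP; rewrite tofrac_eq => /eqP /(congr1 (mcoeff U_(j))).
by rewrite !mcoeffXU eqxx; case: eqP => // _ /eqP; rewrite eq_sym oner_eq0.
Qed.

Definition Kn := subfield_of (fixed_by fsym_action [set: 'S_n]).
HB.instance Definition _ := SubType.on Kn.
HB.instance Definition _ := GRing.Field.on Kn.

Definition Ln := extension_of (@fixed_byT_sub _ _ fsym_action (sym_fix1 n)).
HB.instance Definition _ := SubType.on Ln.
HB.instance Definition _ := GRing.Field.on Ln.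
HB.instance Definition _ := GRing.Algebra.on Ln.

HB.instance Definition _ := Lmodule_hasFinDim.Build Kn Ln
  (fixed_ext_vector_axiom (act := fsym_action) fsymM fsymX ratX_inj).

Lemma dim_Ln : (0 < n)%N -> \dim {:Ln} = n.
Proof. by move=> n_gt0; rewrite dimvf /dim /= prednK. Qed.

End RationalFunctions.

(* Main.v *)
(* Write y_1, ..., y_n for the conjugates of y.  In characteristic 2 the two
   conditions say that the sum of the y_i and the sum of their cubes vanish, and
   both survive multiplication by an S_n-invariant common denominator, so the
   y_i may be taken to be polynomials.  Index the variables by two copies of
   V = (Z/3)^m and adjoin a primitive cube root of unity.  As V has exponent 3
   and the characteristic is 2, the cross terms of the sum of the cubes of the
   Fourier coefficients on V cancel in pairs: the Fourier transform preserves
   sums of cubes.  The Fourier coefficients of y at nontrivial characters are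
   eigenvectors, for pairwise distinct characters, of the group V x V that
   translates the two copies of V separately.  In coordinates where this group
   acts diagonally, the nonzero ones therefore have distinct leading monomials,
   and so do their cubes.  As the sum of these cubes is 0, all nontrivial
   Fourier coefficients are 0; the two trivial ones are equal because their sum is 0, so
   all the y_i are equal and y is fixed by S_n. *)
From Stdlib Require Import Classical_Prop.
From HB Require Import structures.
Require Import Defs.
From mathcomp Require Import all_boot all_order all_fingroup all_algebra all_field.
From mathcomp Require Import generic_quotient mpoly ring.

Set Implicit Arguments.
Unset Strict Implicit.
Unset Printing Implicit Defensive.

(* The second import of Defs makes its fsym take precedence over ssrfun's. *)
Import Defs Order.TTheory GRing.Theory passmx.
Local Open Scope ring_scope.

(** * Similar matrices and Newton's identities *)

Lemma char_poly_similar (K : fieldType) n (P A B : 'M[K]_n) :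
  P \in unitmx -> A *m P = P *m B -> char_poly A = char_poly B.
Proof.
move=> uP AP; rewrite /char_poly; set PC := map_mx polyC P.
have dP : \det PC != 0.
  by rewrite det_map_mx polyC_eq0 -unitfE -unitmxE.
apply: (mulIf dP); rewrite [RHS]mulrC -!det_mulmx; congr (\det _).
rewrite /char_poly_mx mulmxBl mulmxBr -!map_mxM AP.
by rewrite mul_scalar_mx mul_mx_scalar.
Qed.

(* Multiplying by ['X^3] keeps the indices of the three subleading coefficients
   in range, so that the induction starts at the empty product. *)
Lemma coef_prod_XsubC_sum_cubes (R : comNzRingType) (s : seq R)
    (p := \prod_(c <- s) ('X - c%:P) * 'X^3) (n := size s) :
  let a := p`_n.+2 in let b := p`_n.+1 in let c := p`_n in
  \sum_(z <- s) z = - a /\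
  \sum_(z <- s) z ^+ 3 = - a ^+ 3 + a * b *+ 3 - c *+ 3.
Proof.
suff [_ [] //] : p`_n.+3 = 1 /\ let a := p`_n.+2 in let b := p`_n.+1 in
  let c := p`_n in \sum_(z <- s) z = - a /\
  \sum_(z <- s) z ^+ 3 = - a ^+ 3 + a * b *+ 3 - c *+ 3.
rewrite /p /n {p n}; elim: s => [|z s [IH1 [IHs IHc]]] /=.
  by rewrite !big_nil mul1r !coefXn /=; split=> //; split; ring.
rewrite !big_cons -mulrA [X in _ * X]/=.
set q := _ * 'X^3 in IH1 IHs IHc *.
rewrite !mulrBl ![z%:P * _]mulrC !coefB !coefXM !coefMC /= IHs IHc IH1.
have q0 : q`_(size s).+4 = 0.
  rewrite nth_default // /q.
  rewrite size_monicM ?monic_prod_XsubC ?monic_neq0 ?monicXn //.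
  by rewrite size_prod_XsubC size_polyXn /= addnC.
rewrite q0 mul0r subr0; split=> //; split; ring.
Qed.

(** Every term of Newton's identity p_3 = e_1^3 - 3 e_1 e_2 + 3 e_3 contains e_1 or e_3. *)
Lemma sum_cubes_eq0 (R : comNzRingType) (s : seq R) :
  (2 < size s)%N ->
  let p := \prod_(c <- s) ('X - c%:P) in
  p`_(size s - 1) = 0 -> p`_(size s - 3) = 0 ->
  \sum_(c <- s) c = 0 /\ \sum_(c <- s) c ^+ 3 = 0.
Proof.
move=> s_gt2 p; have := coef_prod_XsubC_sum_cubes s; rewrite -/p /=.
case: (size s) s_gt2 => [|[|[|k]]] //= _.
rewrite !coefMXn /= !subSS !subn0 => -[-> ->] -> ->; split; ring.
Qed.

(** * Conjugates and the characteristic polynomial *)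

Section Embeddings.
Context (F : fieldType) (n : nat) (i0 : 'I_n) (i0E : i0 = 0 :> nat).
Implicit Types (y z : Ln F n) (c : Kn F n).

(** The i-th conjugate of [y]; the transposition represents the coset of all permutations sending
    [i0] to [i]. *)
Definition embed i y : ratfun F n := fsym (tperm i0 i) (\val y).

Fact embed_is_zmod_morphism i : zmod_morphism (embed i).
Proof.
move=> y z; have valB : \val (y - z) = \val y - \val z by [].
by rewrite /embed valB [LHS](rmorphB (fsym_action F (tperm i0 i))).
Qed.

Fact embed_is_monoid_morphism i : monoid_morphism (embed i).
Proof.
split=> [|y z]; first exact: (rmorph1 (fsym_action F (tperm i0 i))).
have valM : \val (y * z) = \val y * \val z by [].
by rewrite /embed valM [LHS](rmorphM (fsym_action F (tperm i0 i))).
Qed.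

HB.instance Definition _ i := GRing.isZmodMorphism.Build (Ln F n)
  (ratfun F n) (embed i) (embed_is_zmod_morphism i).
HB.instance Definition _ i := GRing.isMonoidMorphism.Build (Ln F n)
  (ratfun F n) (embed i) (embed_is_monoid_morphism i).

Lemma embedZ i c y : embed i (c *: y) = \val c * embed i y.
Proof.
rewrite /embed /= rmorphM /=; congr (_ * _).
by apply: (fixed_byP _ _ _ (valP c)); rewrite inE.
Qed.

Lemma fsym_embed s i y : fsym s (embed i y) = embed (s i) y.
Proof.
rewrite /embed -fsymM.
set t := (tperm i0 i * s)%g.
(* The factor [t * tperm i0 (s i)] fixes [i0], so it fixes [y]. *)
have -> : t = (t * tperm i0 (s i) * tperm i0 (s i))%g.
  by rewrite -mulgA tperm2 mulg1.
rewrite [LHS]fsymM; congr (fsym _ _).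
have /fixed_byP := valP y; apply; rewrite inE; apply/forallP => j.
apply/implyP => /eqP j0; have -> : j = i0 by apply: val_inj; rewrite /= j0 i0E.
by rewrite !permM tpermL tpermR.
Qed.

Lemma embed_const_fixed y :
  (forall i j, embed i y = embed j y) ->
  \val y \in fixed_by (@fsym_action F n) [set: 'S_n].
Proof.
move=> y_const; have yE : \val y = embed i0 y.
  rewrite /embed tperm1; apply/esym; have /fixed_byP := valP y; apply.
  by rewrite inE; apply/forallP => j; rewrite perm1 eqxx implybT.
by apply/fixed_byP => s _; rewrite yE [LHS]fsym_embed.
Qed.

Lemma exists_generator : exists z, forall i, embed i z = ratX F i.
Proof.
have x_fix : ratX F i0 \in fixed_by (@fsym_action F n) (sym_fix1 n).
  apply/fixed_byP => s; rewrite inE => /forallP /(_ i0).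
  by rewrite i0E eqxx => /eqP s0; rewrite [LHS]fsymX s0.
by exists (Subfield x_fix) => i; rewrite /embed fsymX tpermL.
Qed.

(* In the basis of evaluations at the n conjugates, multiplication by y is
   diagonal.  The evaluation matrix is invertible since it divides the
   Vandermonde matrix of x_1, ..., x_n. *)
Lemma map_mul_char_poly y :
  map_poly (val : Kn F n -> ratfun F n) (mul_char_poly y)
    = \prod_i ('X - (embed i y)%:P).
Proof.
have n_gt0 : (0 < n)%N by rewrite (leq_ltn_trans _ (ltn_ord i0)).
pose E := ratfun F n; pose K := Kn F n; pose L := Ln F n.
pose vK : {rmorphism K -> E} := val.
set d := \dim {: L}; have dE : d = n by exact: dim_Ln.
pose b := vbasis {: L}; have bP : basis_of {: L} b := vbasisP _.
pose s (k : 'I_d) : {rmorphism L -> E} := embed (cast_ord dE k).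
have sZ k (c : K) z : s k (c *: z) = vK c * s k z by exact: embedZ.
pose P : 'M[E]_d := \matrix_(i, k) s k b`_i.
have sP k (z : L) : s k z = \sum_i vK (coord b i z) * P i k.
  rewrite {1}[z](coord_vbasis (memvf z)) rmorph_sum; apply: eq_bigr => i _.
  by rewrite mxE -sZ.
pose M : 'M[K]_d := mxof b b (amull y).
have MP : map_mx vK M *m P = P *m diag_mx (\row_k s k y).
  apply/matrixP => i k; rewrite mul_mx_diag !mxE -rmorphM sP.
  apply: eq_bigr => j _; rewrite mxE; congr (vK _ * _).
  by rewrite mxE /= mxE -(rVofE bP) (rVofK bP) lfunE /= mulrC.
have [g gE] := exists_generator.
have uP : P \in unitmx.
  pose V := Vandermonde d (\row_k s k g).
  pose C : 'M[K]_d := \matrix_(j < d, i < d) coord b i (g ^+ j).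
  have VE : V = map_mx vK C *m P.
    apply/matrixP => j k; rewrite !mxE -rmorphXn sP; apply: eq_bigr => i _.
    by rewrite !mxE.
  have : \det V != 0.
    rewrite det_Vandermonde; apply/prodf_neq0 => i _; apply/prodf_neq0 => j ij.
    rewrite !mxE subr_eq0 /s /= !gE (inj_eq (@ratX_inj F n)).
    by rewrite (inj_eq (@cast_ord_inj _ _ _)) neq_ltn ij orbT.
  by rewrite VE det_mulmx mulf_eq0 negb_or unitmxE unitfE => /andP[].
rewrite /mul_char_poly -/M [LHS](map_char_poly vK).
rewrite (char_poly_similar uP MP) char_poly_trig ?diag_mx_is_trig //.
rewrite (reindex_onto (cast_ord dE) (cast_ord (esym dE))) => [|i _].
  apply: eq_big => [k|k _]; first by rewrite cast_ordK eqxx.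
  by rewrite !mxE eqxx mulr1n.
by rewrite cast_ordKV.
Qed.

Lemma sum_cubes_embed y : (2 < n)%N -> sigma 1 y = 0 -> sigma 3 y = 0 ->
  \sum_i embed i y = 0 /\ \sum_i embed i y ^+ 3 = 0.
Proof.
move=> n_gt2 s1 s3.
pose s := [seq embed i y | i : 'I_n].
have s_size : size s = n by rewrite size_map size_enum_ord.
have pE := map_mul_char_poly y.
have coef0 k : sigma k y = 0 -> (\prod_(c <- s) ('X - c%:P))`_(size s - k) = 0.
  move=> /eqP; rewrite /sigma mulf_eq0 expf_eq0 oppr_eq0 oner_eq0 andbF /=.
  rewrite big_image s_size -pE dim_Ln ?(ltn_trans _ n_gt2) // coef_map.
  by move=> /eqP ->.
have := sum_cubes_eq0 _ (coef0 _ s1) (coef0 _ s3).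
by rewrite s_size !big_image; apply.
Qed.

End Embeddings.

(** * Clearing denominators, symmetric sums, cube roots of unity *)

Lemma tofrac_inj (R : idomainType) : injective (@FracField.tofrac R).
Proof. by move=> a b /eqP; rewrite tofrac_eq => /eqP. Qed.

(** The product [D] of all images of the denominator [b] is symmetric and divisible by [b], so
    multiplying by it yields polynomials and commutes with permutations. *)
Lemma clear_denominators (F : fieldType) n (i0 : 'I_n) (y : Ln F n) :
    i0 = 0%N :> nat ->
  exists2 p : 'I_n -> {mpoly F[n]}, forall s i, msym s (p i) = p (s i) &
  exists2 D, D != 0 & forall i, FracField.tofrac (p i) = D * embed i0 i y.
Proof.
move=> i0E; have [a b b0 yE] := fracP (\val y).
pose q := a * \prod_(s : 'S_n | s != 1%g) msym s b.
pose D := \prod_(s : 'S_n) msym s b.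
have sD s : msym s D = D.
  rewrite rmorph_prod /= [RHS](reindex_inj (mulIg s)) /=.
  by apply: eq_bigr => t _; rewrite msymMm.
have D0 : D != 0.
  by apply/prodf_neq0 => s _; rewrite raddf_eq0 //; exact: inj_msym.
have pE i : FracField.tofrac (msym (tperm i0 i) q)
    = FracField.tofrac D * embed i0 i y.
  rewrite -{1}(sD (tperm i0 i)) -!(frac_map_tofrac _ (@inj_msym _ _ _)).
  rewrite -[RHS](rmorphM (fsym_action F (tperm i0 i))); congr (frac_map _ _).
  rewrite yE /D (bigD1 1%g) //= msym1m /q !tofracM.
  by rewrite [RHS]mulrC mulrA divfK ?tofrac_eq0.
exists (fun i => msym (tperm i0 i) q) => [s i|]; last first.
  by exists (FracField.tofrac D); rewrite ?tofrac_eq0.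
apply: tofrac_inj; rewrite pE -(fsym_embed i0E) -{1}(sD s).
rewrite -[LHS](frac_map_tofrac _ (@inj_msym _ _ s)) pE.
rewrite -(frac_map_tofrac D (@inj_msym _ _ s)).
by rewrite -[RHS](rmorphM (fsym_action F s)).
Qed.

Lemma sum_sym_pchar2 (I : finType) (R : nzRingType) (f : I -> I -> R) :
    2 \in [pchar R] -> (forall i j, f i j = f j i) ->
  \sum_i \sum_j f i j = \sum_i f i i.
Proof.
(* Ranks order [I], so that off the diagonal each term with [lt j i] cancels against its mirror
   image. *)
move=> R2 f_sym; pose lt (i j : I) := (enum_rank i < enum_rank j)%N.
transitivity
  (\sum_i (f i i + \sum_(j | lt j i) f i j + \sum_(j | lt i j) f i j)).
  apply: eq_bigr => i _; rewrite (bigD1 i) //= -addrA; congr (_ + _).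
  rewrite (bigID (lt^~ i)) /=; congr (_ + _); apply: eq_bigl => j.
    rewrite /lt; by case: eqP => // ->; rewrite ltnn.
  by rewrite /lt -leqNgt ltn_neqAle -(inj_eq enum_rank_inj) eq_sym.
rewrite !big_split /= -addrA [X in _ + (X + _)](exchange_big_dep predT) //=.
under [X in _ + (X + _)]eq_bigr do under eq_bigr do rewrite f_sym.
by rewrite addrr_pchar2 // addr0.
Qed.

Lemma exists_cube_root_unity (F : fieldType) :
  exists (L : fieldType) (iota : {rmorphism F -> L}) (w : L),
    w ^+ 2 + w + 1 = 0.
Proof.
pose p : {poly F} := 'X^2 + 'X + 1.
have pE (R : nzRingType) (z : R) : ('X^2 + 'X + 1).[z] = z ^+ 2 + z + 1.
  by rewrite !hornerD hornerXn hornerX hornerC.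
have p_size : size p = 3.
  rewrite /p -addrA size_polyDl size_polyXn //.
  by rewrite size_polyDl ?size_polyX ?size_poly1.
(* Excluded middle, because having a root is not decidable over an arbitrary field; without a root
   the quadratic is irreducible. *)
case: (classic (exists w, root p w)) => [[w /rootP]|no_root].
  by rewrite pE => w_eq0; exists F, idfun, w.
have p_irr : irreducible_poly p.
  apply: cubic_irreducible => [|x]; first by rewrite p_size.
  by apply/negP => ?; apply: no_root; exists x.
have [L _ [w /rootP pw _]] := irredp_FAdjoin p_irr.
exists L, (in_alg L), w; rewrite -pE -pw /p.
by rewrite !rmorphD /= map_polyXn map_polyX rmorph1.
Qed.

(** * Fourier transform on (Z/3)^m in characteristic 2 *)

Section Fourier.
Context (K : fieldType) (w : K) (m : nat).
Hypotheses (K2 : 2%N \in [pchar K]) (w_root : w ^+ 2 + w + 1 = 0).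
Local Notation V := 'rV['Z_3]_m.
Implicit Types a b c : V.

Lemma prim_root3 : 3.-primitive_root w.
Proof.
have w3 : w ^+ 3 = 1.
  apply/eqP; rewrite -subr_eq0.
  have -> : w ^+ 3 - 1 = (w - 1) * (w ^+ 2 + w + 1) by ring.
  by rewrite w_root mulr0.
have [d d_prim d3] := prim_order_exists (isT : 0 < 3)%N w3.
have [d1|d_neq1] := eqVneq d 1%N; last first.
  by move: d_prim; rewrite (prime_nt_dvdP (isT : prime 3) d_neq1 d3).
have w1 : w = 1 by move: (prim_expr_order d_prim); rewrite d1.
move: w_root; rewrite w1.
by rewrite expr1n (addrr_pchar2 K2) add0r => /eqP; rewrite oner_eq0.
Qed.

(** The character of V given by the dot product with [a]; its exponent is a representative modulo 3,
    and w^3 = 1. *)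
Definition chi a b : K := w ^+ (a *m b^T) 0 0.

Lemma chi_sym a b : chi a b = chi b a.
Proof. by rewrite /chi -[a *m _]trmxK trmx_mul trmxK [in LHS]mxE. Qed.

Lemma chiDl a b c : chi (a + b) c = chi a c * chi b c.
Proof.
rewrite /chi mulmxDl mxE -exprD /=.
by rewrite -[RHS](expr_mod _ (prim_expr_order prim_root3)).
Qed.

Lemma chiDr a b c : chi a (b + c) = chi a b * chi a c.
Proof. by rewrite !(chi_sym a) chiDl. Qed.

Lemma chi0l b : chi 0 b = 1.
Proof. by rewrite /chi mul0mx mxE. Qed.

Lemma chi0r a : chi a 0 = 1.
Proof. by rewrite chi_sym chi0l. Qed.

Lemma chiNl a b : chi (- a) b = chi a (- b).
Proof. by rewrite /chi linearN mulNmx mulmxN. Qed.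

Lemma chi_inj a b : chi a =1 chi b -> a = b.
Proof.
move=> ab; apply/rowP => i; have /eqP := ab (delta_mx 0 i).
rewrite /chi trmx_delta -!colE !mxE (eq_prim_root_expr prim_root3).
by rewrite !modn_small => [/eqP/val_inj//||]; exact: ltn_ord.
Qed.

(** Orthogonality of characters; |V| = 3^m is odd, hence equal to 1 in [K]. *)
Lemma sum_chi a : \sum_b chi a b = (a == 0)%:R.
Proof.
case: eqP => [->|/eqP a0].
  under eq_bigr do rewrite chi0l.
  rewrite sumr_const card_mx card_ord mul1n.
  by rewrite natrX -[3%N]/(2 + 1)%N natrD (pcharf0 K2) add0r expr1n.
have [b ab] : exists b, chi a b != 1.
  apply/existsP; apply: contraR a0; rewrite negb_exists => /forallP a1.
  by apply/eqP/chi_inj => b; rewrite chi0l; move: (a1 b); rewrite negbK => /eqP.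
have : (chi a b - 1) * (\sum_b chi a b) == 0.
  rewrite mulrBl mul1r subr_eq0 [X in _ == X](reindex_inj (addrI b)) mulr_sumr.
  by apply/eqP; apply: eq_bigr => c _; rewrite chiDr.
by rewrite mulf_eq0 subr_eq0 (negPf ab) /= => /eqP.
Qed.

Section Transform.
Context (A : comAlgType K).
Implicit Types y : V -> A.

Definition fourier y a : A := \sum_b chi a b *: y b.

Lemma fourier_shift y c a :
  fourier (fun b => y (b + c)) a = chi a (- c) *: fourier y a.
Proof.
rewrite /fourier [in RHS](reindex_inj (addIr c)) scaler_sumr.
apply: eq_bigr => b _.
by rewrite scalerA -chiDr [- c + _]addrC addrK.
Qed.

Lemma fourier_inv y b : fourier (fun a => fourier y (- a)) b = y b.
Proof.
rewrite /fourier; under eq_bigr do rewrite scaler_sumr.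
have chi_sub c : \sum_a chi b a * chi (- a) c = (b == c)%:R.
  rewrite -subr_eq0 -sum_chi; apply: eq_bigr => a _.
  by rewrite chiNl (chi_sym b) -chiDr chi_sym.
rewrite exchange_big; transitivity (\sum_c (b == c)%:R *: y c).
  apply: eq_bigr => c _; under eq_bigr do rewrite scalerA.
  by rewrite -scaler_suml chi_sub.
rewrite (bigD1 b) //= eqxx scale1r big1 ?addr0 // => c.
by rewrite eq_sym => /negPf ->; rewrite scale0r.
Qed.

(** Summing over characters keeps the products with b + c + d = 0. These are symmetric in [b] and
    [c], so only b = c survives, and then d = -2b = b. *)
Lemma sum_fourier_cubes y : \sum_a fourier y a ^+ 3 = \sum_b y b ^+ 3.
Proof.
have cubeE a : fourier y a ^+ 3
    = \sum_b \sum_c \sum_d chi a (b + c + d) *: (y b * y c * y d).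
  rewrite !exprS expr0 mulr1 {1}/fourier mulr_suml; apply: eq_bigr => b _.
  rewrite {1}/fourier mulr_suml mulr_sumr; apply: eq_bigr => c _.
  rewrite !mulr_sumr; apply: eq_bigr => d _.
  by rewrite !chiDr -!scalerAl -!scalerAr !scalerA !mulrA.
under eq_bigr do rewrite cubeE.
rewrite exchange_big; under eq_bigr do rewrite exchange_big.
under eq_bigr do under eq_bigr do rewrite exchange_big.
have sum_d b c : \sum_d \sum_a chi a (b + c + d) *: (y b * y c * y d)
    = y b * y c * y (- (b + c)).
  have sum_a d : \sum_a chi a d = (d == 0)%:R.
    by rewrite -sum_chi; apply: eq_bigr => a _; rewrite chi_sym.
  under eq_bigr do rewrite -scaler_suml sum_a.
  rewrite (bigD1 (- (b + c))) //= subrr eqxx scale1r big1 ?addr0 // => d.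
  by rewrite -addr_eq0 addrC => /negPf ->; rewrite scale0r.
under eq_bigr do under eq_bigr do rewrite sum_d.
rewrite sum_sym_pchar2 => [||b c]; first 1 last.
- by rewrite (rmorph_pchar (in_alg A)).
- by rewrite [y b * _]mulrC [b + c]addrC.
apply: eq_bigr => b _; rewrite !exprS expr0 mulr1 mulrA; congr (_ * y _).
apply/rowP => i; rewrite !mxE; apply: val_inj.
by case: (b 0 i) => -[|[|[|]]].
Qed.
End Transform.
End Fourier.

(** * Diagonal substitutions and leading monomials *)

Section Polynomials.
Lemma mpoly_rmorph_ext n (R : nzRingType) (S : comNzRingType)
    (f g : {rmorphism {mpoly R[n]} -> S}) :
    (forall c, f c%:MP = g c%:MP) -> (forall i, f 'X_i = g 'X_i) -> f =1 g.
Proof.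
move=> fgC fgX p; rewrite (mpolyE p) !rmorph_sum; apply: eq_bigr => /= mu _.
rewrite -mul_mpolyC !rmorphM /= fgC mpolyXE_id !rmorph_prod; congr (_ * _).
by apply: eq_bigr => i _; rewrite !rmorphXn /= fgX.
Qed.

Definition dilation n (K : comNzRingType) (l : 'I_n -> K) :
    {mpoly K[n]} -> {mpoly K[n]} :=
  mmap (@mpolyC n K) (fun i => l i *: 'X_i).

HB.instance Definition _ n K l := GRing.RMorphism.on (@dilation n K l).

(** Monomials are eigenvectors of a dilation, so the eigenvalue of an eigenvector can be read off
    its leading monomial. *)
Lemma mcoeff_dilation n (K : comNzRingType) (l : 'I_n -> K)
    (p : {mpoly K[n]}) mu :
  (dilation l p)@_mu = (\prod_i l i ^+ mu i) * p@_mu.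
Proof.
rewrite {1}(mpolyE p) [dilation l _]rmorph_sum raddf_sum /=.
rewrite [p in RHS]mpolyE raddf_sum mulr_sumr /=; apply: eq_bigr => nu _.
rewrite /dilation mmapZ mmapX /mmap1 mcoeffCM mcoeffZ mcoeffX.
rewrite (eq_bigr _ (fun i _ => exprZn _ _ _)) scaler_prod -mpolyXE_id.
rewrite mcoeffZ mcoeffX.
by case: eqP => [->|_]; rewrite ?mulr1 ?mulr0 // mulrC.
Qed.

(** Three times the largest leading monomial occurs in only one of the cubes, so nothing can cancel
    it. *)
Lemma sum_cubes_distinct_mlead n (K : idomainType) (I : finType) (P : pred I)
    (q : I -> {mpoly K[n]}) :
    (forall i j, P i -> P j -> q i != 0 -> q j != 0 ->
       mlead (q i) = mlead (q j) -> i = j) ->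
  \sum_(i | P i) q i ^+ 3 = 0 -> forall i, P i -> q i = 0.
Proof.
move=> q_inj q0 i Pi; apply/eqP/negPn/negP => qi.
pose Q k := P k && (q k != 0); have Qi : Q i by rewrite /Q Pi.
have [j /andP[Pj qj] j_max] := arg_maxP (fun k => mlead (q k)) Qi.
have := congr1 (mcoeff (mlead (q j) *+ 3)) q0.
rewrite raddf_sum /= (bigD1 j) //=.
rewrite mleadcX big1 => [|k /andP[Pk kj]].
  by rewrite addr0 mcoeff0 => /eqP; rewrite expf_eq0 /= mleadc_eq0 (negPf qj).
have [->|qk] := eqVneq (q k) 0; first by rewrite expr0n mcoeff0.
apply: mcoeff_gt_mlead; rewrite mleadX //.
have lt : (mlead (q k) < mlead (q j))%O.
  have le_kj : (mlead (q k) <= mlead (q j))%O by apply: j_max; rewrite /Q Pk.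
  by rewrite lt_neqAle le_kj andbT; apply: contraNneq kj => /q_inj ->.
by rewrite !mulmS !mulm0n !addm0 !ltm_add.
Qed.
End Polynomials.

(** * Equivariant families indexed by two copies of V *)

Section Equivariant.
Context (F K : fieldType) (iota : {rmorphism F -> K}) (w : K) (m : nat).
Hypotheses (K2 : 2%N \in [pchar K]) (w_root : w ^+ 2 + w + 1 = 0).
Local Notation V := 'rV['Z_3]_m.
Local Notation T := (bool * V)%type.
Local Notation n := #|{: T}|.
Local Notation X t := ('X_(enum_rank t) : {mpoly K[n]}).
Local Notation dft := (fourier w).
Implicit Types (e : bool) (a b c : V) (t : T) (i j : 'I_n).

(** A linear change of variables, the Fourier transform on each copy of V, that makes translations
    act diagonally. *)
Definition diagonalize : {mpoly F[n]} -> {mpoly K[n]} :=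
  mmap (@mpolyC n K \o iota)
    (fun i => let t := enum_val i in dft (fun a => X (t.1, a)) t.2).
HB.instance Definition _ := GRing.RMorphism.on diagonalize.

(** The sign is that of [fourier_inv]. *)
Definition undiagonalize : {mpoly K[n]} -> {mpoly K[n]} :=
  mmap (@mpolyC n K)
    (fun i => let t := enum_val i in dft (fun b => X (t.1, b)) (- t.2)).
HB.instance Definition _ := GRing.RMorphism.on undiagonalize.

Lemma diagonalizeX e b :
  diagonalize 'X_(enum_rank (e, b)) = dft (fun a => X (e, a)) b.
Proof. by rewrite /diagonalize mmapX mmap1U enum_rankK. Qed.

Lemma diagonalizeK p : undiagonalize (diagonalize p) = map_mpoly iota p.
Proof.
pose f : {rmorphism {mpoly F[n]} -> {mpoly K[n]}} :=
  undiagonalize \o diagonalize.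
apply: (mpoly_rmorph_ext (f := f)) => [c|i]; rewrite /f /=.
  by rewrite /diagonalize mmapC /= /undiagonalize mmapC map_mpolyC.
rewrite -(enum_valK i); case: (enum_val i) => e b.
rewrite diagonalizeX map_mpolyX rmorph_sum /=.
rewrite -(fourier_inv K2 w_root (fun b => X (e, b)) b).
apply: eq_bigr => a _; rewrite [LHS]mmapZ mmapX mmap1U enum_rankK.
by rewrite mul_mpolyC.
Qed.

Lemma diagonalize_inj : injective diagonalize.
Proof.
move=> p q /(congr1 undiagonalize); rewrite !diagonalizeK => pq.
apply/mpolyP => mu; apply: (fmorph_inj iota).
by rewrite -!mcoeff_map_mpoly pq.
Qed.

Definition translate e c t : T := if t.1 == e then (t.1, t.2 + c) else t.

Lemma translate_inj e c :
  injective (fun i : 'I_n => enum_rank (translate e c (enum_val i))).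
Proof.
move=> i j /enum_rank_inj ij; apply: enum_val_inj.
move: ij; rewrite /translate.
case: (enum_val i) (enum_val j) => [e1 a] [e2 b] /=.
have [->|e1n] := eqVneq e1 e; have [->|e2n] := eqVneq e2 e => -[].
- by move/addIr->.
- by move=> e2E; rewrite e2E eqxx in e2n.
- by move=> e1E; rewrite e1E eqxx in e1n.
- by move=> -> ->.
Qed.

Definition translation e c : 'S_n := perm (@translate_inj e c).

Definition weight e c t : K := if t.1 == e then chi w t.2 c else 1.

(** In the transform of the variables, replacing b by b + c multiplies the coefficient of X_(e,a) by
    [chi w a c]. *)
Lemma diagonalize_msym e c p :
  diagonalize (msym (translation e c) p)
    = dilation (weight e c \o enum_val) (diagonalize p).
Proof.
pose f : {rmorphism {mpoly F[n]} -> {mpoly K[n]}} :=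
  diagonalize \o msym (translation e c).
pose g : {rmorphism {mpoly F[n]} -> {mpoly K[n]}} :=
  dilation (weight e c \o enum_val) \o diagonalize.
apply: (mpoly_rmorph_ext (f := f) (g := g)) => [z|i]; rewrite /f /g /=.
  by rewrite /msym mmapC /diagonalize !mmapC /= /dilation mmapC.
rewrite -(enum_valK i); case: (enum_val i) => e1 b.
rewrite [msym _ _]mmapX mmap1U permE enum_rankK /translate diagonalizeX.
rewrite /weight rmorph_sum /=.
case: eqP => [->|/eqP/negPf e1e] /=; rewrite diagonalizeX;
  apply: eq_bigr => a _.
  rewrite [RHS]mmapZ mmapX mmap1U /= enum_rankK /= eqxx mul_mpolyC scalerA.
  by rewrite chi_sym chiDr // chi_sym mulrC.
by rewrite [RHS]mmapZ mmapX mmap1U /= enum_rankK /= e1e mul_mpolyC scale1r.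
Qed.

Context (p : 'I_n -> {mpoly F[n]}).
Hypothesis p_equivariant : forall s i, msym s (p i) = p (s i).

Let P t := diagonalize (p (enum_rank t)).
(** A second Fourier transform, now of the family [P] itself rather than of the variables. *)
Let W t := dft (fun b => P (t.1, b)) t.2.

(** By equivariance the dilation translates the indices of [P], and the transform turns a
    translation into a scalar. *)
Lemma dilation_W e c t :
  dilation (weight e c \o enum_val) (W t) = weight e (- c) t *: W t.
Proof.
have dilP u : dilation (weight e c \o enum_val) (P u) = P (translate e c u).
  by rewrite -diagonalize_msym p_equivariant permE enum_rankK.
transitivity (dft (fun b => P (translate e c (t.1, b))) t.2).
  rewrite rmorph_sum; apply: eq_bigr => b _.
  by rewrite -dilP [LHS]mmapZ mul_mpolyC.
rewrite /W /translate /weight /=; case: eqP => _; last by rewrite scale1r.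
exact: (fourier_shift K2 w_root).
Qed.

(** The leading monomial determines the eigenvalues under all dilations, hence the copy and the
    nontrivial character. *)
Lemma W_distinct_mlead t u : t.2 != 0 -> u.2 != 0 -> W t != 0 -> W u != 0 ->
  mlead (W t) = mlead (W u) -> t = u.
Proof.
move=> t0 u0 Wt Wu tu.
have weightE e c v : W v != 0 -> weight e (- c) v
    = \prod_i (weight e c \o enum_val) i ^+ mlead (W v) i.
  rewrite -mleadc_eq0 => Wv; apply: (mulIf Wv).
  by rewrite -mcoeff_dilation dilation_W mcoeffZ.
have eq_weight e c : weight e c t = weight e c u.
  rewrite -[c]opprK (weightE e (- c) t Wt) tu.
  exact/esym/weightE.
case: t u t0 u0 eq_weight {Wt Wu tu weightE} => e a [e' b] /= a0 _ eq_weight.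
have := eq_weight e; rewrite /weight /= eqxx; case: eqP => [-> ab|_ a1].
  by rewrite (chi_inj K2 w_root ab).
(* On different copies, translating copy [e] has weight 1 on the second index, so [a] would be
   trivial. *)
suff a_eq0 : a = 0 by rewrite a_eq0 eqxx in a0.
by apply: (chi_inj K2 w_root) => c; rewrite a1 chi0l.
Qed.

Lemma equivariant_constant :
  \sum_i p i = 0 -> \sum_i p i ^+ 3 = 0 -> forall i j, p i = p j.
Proof.
have KX2 : 2%N \in [pchar {mpoly K[n]}].
  by rewrite (rmorph_pchar (@mpolyC n K)).
have sumP (k : nat) : \sum_i p i ^+ k = 0 -> \sum_e \sum_b P (e, b) ^+ k = 0.
  move=> /(congr1 diagonalize); rewrite rmorph0 rmorph_sum => pk.
  rewrite -[RHS]pk pair_bigA /= [RHS](reindex enum_rank) /=; last first.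
    exact/onW_bij/enum_rank_bij.
  by apply: eq_bigr => -[e b] _; rewrite rmorphXn.
move=> p1 p3.
have W0 : W (true, 0) = W (false, 0).
  have W0E e : W (e, 0) = \sum_b P (e, b).
    by apply: eq_bigr => b _; rewrite /= chi0l scale1r.
  apply/eqP; rewrite -subr_eq0 oppr_pchar2 // !W0E.
  by have := sumP 1%N p1; rewrite big_bool /= => ->.
have W3 : \sum_(t | t.2 != 0) W t ^+ 3 = 0.
  have sum3 : \sum_e \sum_a W (e, a) ^+ 3 = 0.
    rewrite -[RHS](sumP 3%N p3); apply: eq_bigr => e _.
    exact: (sum_fourier_cubes K2 w_root (fun b => P (e, b))).
  have split0 e : \sum_a W (e, a) ^+ 3
      = W (e, 0) ^+ 3 + \sum_(a | a != 0) W (e, a) ^+ 3 by rewrite (bigD1 0).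
  move: sum3; under eq_bigr do rewrite split0.
  (* The cubes of the two trivial coefficients are equal and cancel. *)
  rewrite big_split big_bool /= W0 addrr_pchar2 // add0r pair_big_dep /=.
  move=> sum3.
  by rewrite -[RHS]sum3; apply: eq_big => -[].
have W_eq0 := sum_cubes_distinct_mlead W_distinct_mlead W3.
have PE e b : P (e, b) = W (e, 0).
  rewrite -[LHS](fourier_inv K2 w_root (fun b => P (e, b)) b).
  rewrite {1}/fourier (bigD1 0) //= big1 => [|a a0].
    by rewrite chi0r scale1r oppr0 addr0.
  by rewrite [dft _ _](W_eq0 (e, - a)) ?scaler0 ?oppr_eq0.
have P_const t : P t = W (false, 0).
  by case: t => -[] b; rewrite PE ?W0.
move=> i j; apply: diagonalize_inj.
by rewrite -(enum_valK i) -(enum_valK j) -!/(P _) !P_const.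
Qed.
End Equivariant.

Theorem theorem2 (F : fieldType) (char2 : 2%N \in [pchar F])
    (m : nat) (m_ge1 : (1 <= m)%N) (n : nat) (n_def : n = (2 * 3 ^ m)%N) :
  ~ exists y : Ln F n,
      [/\ \val y \notin fixed_by (@fsym_action F n) [set: 'S_n],
          sigma 1 y = 0 & sigma 3 y = 0].
Proof.
case=> y [y_nfix s1 s3]; apply/negP: y_nfix; rewrite negbK.
have n_card : n = #|{: bool * 'rV['Z_3]_m}|.
  by rewrite card_prod card_bool card_mx card_ord mul1n.
have n_gt2 : (2 < n)%N.
  by rewrite n_def -{1}[2%N]muln1 ltn_pmul2l // -(expn0 3) ltn_exp2l.
pose i0 : 'I_n := Ordinal (ltn_trans (isT : 0 < 2)%N n_gt2).
have i0E : i0 = 0%N :> nat by [].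
have [sum1 sum3] := sum_cubes_embed i0E n_gt2 s1 s3.
apply: (embed_const_fixed i0E) => i j.
have [p p_sym [D D0 pE]] := clear_denominators y i0E.
apply: (mulfI D0); rewrite -!pE; congr FracField.tofrac.
have p1 : \sum_i p i = 0.
  apply: tofrac_inj; rewrite rmorph0 rmorph_sum /=.
  by under eq_bigr do rewrite pE; rewrite -mulr_sumr sum1 mulr0.
have p3 : \sum_i p i ^+ 3 = 0.
  apply: tofrac_inj; rewrite rmorph0 rmorph_sum /=.
  under eq_bigr do rewrite rmorphXn /= pE exprMn.
  by rewrite -mulr_sumr sum3 mulr0.
have [K [iota [w w_root]]] := exists_cube_root_unity F.
have K2 : 2%N \in [pchar K] by rewrite (fmorph_pchar iota).
(* Only the data on polynomials are kept, so that [n] can be replaced by the cardinality of the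
   index type. *)
move: p p_sym p1 p3 i j {pE}; clear -iota K2 w_root n_card; rewrite {}n_card.
exact: (equivariant_constant iota K2 w_root).
Qed.
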